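(* Let $\mathbb{F}_q$ be a finite field. (1) Let $a_1\in M_{n_1}(\mathbb{F}_q)$ and $a_2\in M_{n_2}(\mathbb{F}_q)$ be matrices whose characteristic polynomials are relatively prime, and let $a_1\oplus a_2=\begin{pmatrix} a_1&0\\0&a_2\end{pmatrix}\in M_{n_1+n_2}(\mathbb{F}_q)$. Then $$K_{n_1+n_2}(a_1\oplus a_2)=q^{n_1n_2}K_{n_1}(a_1)K_{n_2}(a_2).$$ (2) Let $a\in M_n(\mathbb{F}_q)$ have characteristic polynomial $\prod_{i=1}^n(\lambda-\alpha_i)$ with $\alpha_i\in\mathbb{F}_q$ all different. Then $$K_n(a)=q^{n(n-1)/2}\prod_{i=1}^nK_1(\alpha_i).$$
   Context: $\mathbb{F}_q$ is a finite field of characteristic $p$. The additive character $\varphi:\mathbb{F}_q\to\mathbb{C}^*$ is $\varphi(x)=\exp(2\pi i\,\mathrm{Tr}_{\mathbb{F}_q/\mathbb{F}_p}(x)/p)$, and $\psi=\varphi\circ\mathrm{tr}$ on $M_n(\mathbb{F}_q)$, where $\mathrm{tr}$ is the matrix trace. For $a\in M_n(\mathbb{F}_q)$, $$K_n(a)=\sum_{x\in \mathrm{GL}_n(\mathbb{F}_q)}\psi(ax+x^{-1}),$$ so in particular $K_1(\alpha)=\sum_{x\in\mathbb{F}_q^*}\varphi(\alpha x+x^{-1})$ for $\alpha\in\mathbb{F}_q$. *)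

(* Defs.v *)
From HB Require Import structures.
From mathcomp Require Import all_boot all_order all_algebra all_field.
From mathcomp Require Import complex.
From mathcomp Require Import all_classical all_reals all_analysis.

Set Implicit Arguments.
Unset Strict Implicit.
Unset Printing Implicit Defensive.

Import Order.TTheory GRing.Theory Num.Theory.

Local Open Scope ring_scope.

(* The Galois trace lies in the line <[1]> = F_p; its coordinate on the basis
   (1) is the corresponding element of 'F_p. *)
Definition Fp_trace (F : finFieldType) (p : nat) (pcharFp : p \in [pchar F])
    (x : F) : 'F_p :=
  coord [tuple 1] 0 (galTrace (L := pPrimeCharType pcharFp) 1 fullv x).

(* exp (i t) *)
Definition expi (R : realType) (t : R) : R[i] := (cos t +i* sin t)%C.

Definition add_char (R : realType) (F : finFieldType) (p : nat)
    (pcharFp : p \in [pchar F]) (x : F) : R[i] :=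
  expi (2 * pi * (Fp_trace pcharFp x : nat)%:R / p%:R).

Definition mx_char (R : realType) (F : finFieldType) (p : nat)
    (pcharFp : p \in [pchar F]) (n : nat) (x : 'M[F]_n) : R[i] :=
  add_char R pcharFp (\tr x).

(* ['GL_n[F]] is not used as the index set since it is by definition a set of
   matrices of size [n.-1.+1]. *)
Definition kloosterman (R : realType) (F : finFieldType) (p : nat)
    (pcharFp : p \in [pchar F]) (n : nat) (a : 'M[F]_n) : R[i] :=
  \sum_(x : 'M[F]_n | x \in unitmx) mx_char R pcharFp (a *m x + invmx x).

(* Main.v *)
Require Import Defs.
From mathcomp Require Import all_boot all_order all_algebra all_field.
From mathcomp Require Import complex.
From mathcomp Require Import all_classical all_reals all_analysis.
From mathcomp Require Import zify lra.
Import GRing.Theory.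
Import Order.TTheory Num.Theory.
Local Open Scope ring_scope.

Set Implicit Arguments.
Unset Strict Implicit.
Unset Printing Implicit Defensive.

(** The sum [K(a)] depends only on the similarity class of [a]
([kloosterman_similar]), because the summand is a function of traces and the
summation set is stable under conjugation.  When [a1] and [a2] have coprime
characteristic polynomials, the Sylvester map [v |-> v a2 - a1 v] is bijective,
and conjugating by the unipotent matrix with upper right block [v] shows that
every block triangular matrix [(a1, w; 0, a2)] is similar to [a1 (+) a2]
([kloosterman_add_ur]).

Hence [K(a1 (+) a2)] is the average of [K(a1, w; 0, a2)] over all [w].  In the
term of index [x], the block [w] contributes exactly the factor
[psi(w x21)], where [x21] is the lower left block of [x].  As [psi] is a
nontrivial additive character, averaging over [w] kills every [x] with
[x21 != 0] ([sum_mx_char]).  What remains is the sum over invertible block upper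
triangular [x], in which the summand factors and does not depend on the upper
right block of [x]; that block accounts for the power of [q]
([sum_unit_ublock]).  This is [kloosterman_block_diag].

For the second claim, a matrix whose characteristic polynomial has distinct
roots in the field is similar to the diagonal matrix of its roots, and the first
claim splits off the diagonal entries one at a time ([kloosterman_diag]).

The one fact about [psi] that needs an argument is that it is nontrivial: this
is the independence of field automorphisms, by which the Galois trace does not
vanish identically ([Fp_trace_neq0]). *)

(** * The exponential on the unit circle *)

Lemma expi0 (R : realType) : expi (0 : R) = 1.
Proof. by rewrite /expi cos0 sin0. Qed.

Lemma expiD (R : realType) (s t : R) : expi (s + t) = expi s * expi t.
Proof.
rewrite /expi cosD sinD /GRing.mul /=; congr (_ +i* _)%C.
by rewrite addrC.
Qed.

Lemma expiMn (R : realType) (t : R) (n : nat) : expi (t *+ n) = expi t ^+ n.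
Proof.
elim: n => [|n IHn]; first by rewrite mulr0n expr0 expi0.
by rewrite mulrS expiD IHn exprS.
Qed.

Lemma expi2pi (R : realType) : expi (2 * pi : R) = 1.
Proof. by rewrite /expi mulr_natl cos2pi sin2pi. Qed.

(** The sine of half the angle is positive, so [cos t = 1 - 2 sin^2 (t/2)] is less
than [1]. *)
Lemma expi_neq1 (R : realType) (t : R) : 0 < t < 2 * pi -> expi t != 1.
Proof.
move=> /andP[t_gt0 t_lt]; apply/eqP => -[cost1 _].
have sin_gt0 : 0 < sin (t / 2).
  by apply: sin_gt0_pi; apply/andP; split; lra.
have := cos2Dsin2 (t / 2).
have : cos t = cos (t / 2) ^+ 2 *+ 2 - 1.
  by rewrite -cos_mulr2n mulr2n -splitr.
rewrite cost1; nra.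
Qed.

(** * Linear algebra *)

Lemma invmx_uniq (S : comUnitRingType) (n : nat) (a b : 'M[S]_n) :
  a *m b = 1%:M -> invmx a = b.
Proof.
move=> ab1; have [a_unit _] := mulmx1_unit ab1.
by rewrite -[RHS](mulKmx a_unit) ab1 mulmx1.
Qed.

Lemma invmx_ublock (S : comUnitRingType) (n1 n2 : nat) (x1 : 'M[S]_n1)
    (y : 'M[S]_(n1, n2)) (x2 : 'M[S]_n2) :
  x1 \in unitmx -> x2 \in unitmx ->
  invmx (block_mx x1 y 0 x2) =
    block_mx (invmx x1) (- (invmx x1 *m y *m invmx x2)) 0 (invmx x2).
Proof.
move=> x1_unit x2_unit; apply: invmx_uniq; rewrite mulmx_block.
rewrite !mul0mx !mulmx0 !addr0 add0r mulmxN !mulmxA !mulmxV // mul1mx addNr.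
by rewrite -scalar_mx_block.
Qed.

(** Such a [v] intertwines [q(a)] and [q(b)] for every polynomial [q].  If
[f * char_poly a + g * char_poly b = 1], Cayley-Hamilton applied to both [a] and
[b] turns [v = 1 *m v] into [0]. *)
Lemma sylvester_inj (F : fieldType) (m n : nat) (a : 'M[F]_m) (b : 'M[F]_n)
    (v : 'M[F]_(m, n)) :
  coprimep (char_poly a) (char_poly b) -> a *m v = v *m b -> v = 0.
Proof.
case: m n a b v => [|m] [|n] a b v; rewrite ?(flatmx0 v) ?(thinmx0 v) //.
move=> /Bezout_eq1_coprimepP[[/= f g] fg1] av_vb.
have intertwine q : horner_mx a q *m v = v *m horner_mx b q.
  elim/poly_ind: q => [|q c IHq]; first by rewrite !rmorph0 mul0mx mulmx0.
  rewrite !(rmorphD, rmorphM) /= !horner_mx_X !horner_mx_C.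
  rewrite mulmxDl mulmxDr -!mulmxE -mulmxA av_vb !mulmxA IHq.
  by rewrite scalar_mxC.
have := congr1 (fun q => horner_mx a q *m v) fg1.
rewrite rmorph1 mul1mx => <-.
rewrite rmorphD !rmorphM /= Cayley_Hamilton mulr0 add0r -mulmxE -mulmxA.
by rewrite intertwine Cayley_Hamilton !mulmx0.
Qed.

(** By [sylvester_inj] this additive endomorphism of a finite group has trivial
kernel, so it is bijective. *)
Lemma sylvester_onto (F : finFieldType) (m n : nat) (a : 'M[F]_m)
    (b : 'M[F]_n) (w : 'M[F]_(m, n)) :
  coprimep (char_poly a) (char_poly b) -> exists v, v *m b - a *m v = w.
Proof.
move=> co_ab; pose f v : 'M[F]_(m, n) := v *m b - a *m v.
have f_inj : injective f.
  move=> v1 v2 /eqP; rewrite -subr_eq0 => /eqP f12.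
  apply/eqP; rewrite -subr_eq0; apply/eqP.
  apply: (sylvester_inj co_ab); apply/esym/eqP; rewrite -subr_eq0.
  rewrite mulmxBl mulmxBr -f12 /f; apply/eqP.
  by rewrite !opprB addrACA [in RHS]addrACA (addrC (- _)).
by exists (invF f_inj w); apply: (f_invF f_inj).
Qed.

Lemma char_poly_similar (F : fieldType) (n : nat) (P a b : 'M[F]_n) :
  P \in unitmx -> P *m a = b *m P -> char_poly a = char_poly b.
Proof.
move=> P_unit Pa_bP; pose PX := map_mx polyC P.
have PX_neq0 : \det PX != 0.
  by rewrite det_map_mx polyC_eq0 -unitfE -unitmxE.
apply: (mulfI PX_neq0).
rewrite /char_poly -[LHS]det_mulmx [RHS]mulrC -[RHS]det_mulmx.
rewrite /char_poly_mx mulmxBr mulmxBl.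
by rewrite -!map_mxM Pa_bP scalar_mxC.
Qed.

Lemma char_poly_diag (S : comNzRingType) (n : nat) (d : 'rV[S]_n) :
  char_poly (diag_mx d) = \prod_(i < n) ('X - (d 0 i)%:P).
Proof.
rewrite char_poly_trig ?diag_mx_is_trig //.
by apply: eq_bigr => i _; rewrite mxE eqxx.
Qed.

(** The minimal polynomial divides the characteristic one, hence is split with
simple roots. *)
Lemma similar_diag_of_distinct_roots (F : fieldType) (n : nat) (a : 'M[F]_n)
    (rs : seq F) :
  uniq rs -> char_poly a = \prod_(r <- rs) ('X - r%:P) ->
  exists2 P, P \in unitmx & exists d, P *m a = diag_mx d *m P.
Proof.
case: n a => [|n] a rs_uniq chara.
  by exists 1%:M; [exact: unitmx1 | exists 0; rewrite !thinmx0].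
have [P P_unit Pdiag] : exists2 P, P \in unitmx & similar_diag P a.
  by apply/diagonalizableP; exists rs; rewrite // -chara mxminpoly_dvd_char.
have /similar_diagPex[d /(similarP P_unit) Pad] := Pdiag.
by exists P => //; exists d.
Qed.

(** * The additive character *)

Section AdditiveCharacter.

Variables (R : realType) (F : finFieldType) (p : nat).
Hypothesis pcharFp : p \in [pchar F].

Let p_prime : prime p. Proof. exact: pcharf_prime pcharFp. Qed.

Lemma Fp_traceD (x y : F) :
  Fp_trace pcharFp (x + y) = Fp_trace pcharFp x + Fp_trace pcharFp y.
Proof.
rewrite /Fp_trace.
rewrite (raddfD (galTrace (L := pPrimeCharType pcharFp) 1 fullv) x y).
exact: raddfD.
Qed.

Lemma Fp_trace0 : Fp_trace pcharFp 0 = 0.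
Proof. by apply: (addrI (Fp_trace pcharFp 0)); rewrite -Fp_traceD !addr0. Qed.

(** A vanishing trace would be a linear relation, with all coefficients [1],
between the automorphisms of the field. *)
Lemma Fp_trace_neq0 : exists x : F, Fp_trace pcharFp x != 0.
Proof.
pose L := pPrimeCharType pcharFp.
have [||a _] := @gal_independent_contra _ L fullv
  (mem 'Gal({:L} / 1)%g) (fun=> 1) 1%g _.
- exact: fingroup.group1.
- exact: oner_neq0.
under eq_bigr do rewrite mul1r.
move=> tra_neq0; exists a; apply: contra tra_neq0.
have tra_base : galTrace (L := L) 1 fullv a \in <<[tuple (1%R : L)]>>%VS.
  rewrite span_seq1.
  exact: (mem_galTrace (finField_galois (sub1v _)) (memvf a)).
rewrite /Fp_trace => /eqP coord0.
have := coord_span tra_base; rewrite big_ord1 coord0 scale0r => tra0.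
by apply/eqP.
Qed.

(** Natural representatives of elements of ['F_p] add up only modulo [p]; in this
form the defect is absorbed by [expi_root_unity]. *)
Lemma add_charE (x : F) :
  add_char R pcharFp x = expi (2 * pi / p%:R) ^+ Fp_trace pcharFp x.
Proof. by rewrite -expiMn /add_char mulrAC mulr_natr. Qed.

Lemma expi_root_unity : expi (2 * pi / p%:R : R) ^+ p = 1.
Proof.
rewrite -expiMn -[_ *+ p]mulr_natr divfK ?expi2pi //.
by rewrite pnatr_eq0 -lt0n prime_gt0.
Qed.

Lemma add_charD (x y : F) :
  add_char R pcharFp (x + y) = add_char R pcharFp x * add_char R pcharFp y.
Proof.
rewrite !add_charE -exprD Fp_traceD -(expr_mod _ expi_root_unity).
rewrite -[RHS](expr_mod _ expi_root_unity).
by rewrite /= [X in (_ %% X %% _)%N]Fp_cast // modn_mod.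
Qed.

Lemma add_char0 : add_char R pcharFp 0 = 1.
Proof. by rewrite add_charE Fp_trace0. Qed.

Lemma add_char_nontrivial : exists x : F, add_char R pcharFp x != 1.
Proof.
have [x trx_neq0] := Fp_trace_neq0; exists x.
have p_gt0 : 0 < p%:R :> R by rewrite ltr0n prime_gt0.
have trx_gt0 : (0 < Fp_trace pcharFp x)%N by rewrite lt0n.
have trx_lt : (Fp_trace pcharFp x < p)%N.
  by rewrite (leq_trans (ltn_ord _)) // Fp_cast.
have pi2_gt0 : 0 < 2 * pi :> R by rewrite mulr_gt0 ?pi_gt0.
apply: expi_neq1; apply/andP; split.
  by rewrite divr_gt0 // mulr_gt0 // ltr0n.
by rewrite ltr_pdivrMr // ltr_pM2l ?ltr_nat.
Qed.

Lemma mx_charD (n : nat) (x y : 'M[F]_n) :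
  mx_char R pcharFp (x + y) = mx_char R pcharFp x * mx_char R pcharFp y.
Proof. by rewrite /mx_char mxtraceD add_charD. Qed.

Lemma mx_char_block (m n : nat) (a : 'M[F]_m) (b : 'M[F]_(m, n))
    (c : 'M[F]_(n, m)) (d : 'M[F]_n) :
  mx_char R pcharFp (block_mx a b c d) =
    mx_char R pcharFp a * mx_char R pcharFp d.
Proof. by rewrite /mx_char mxtrace_block add_charD. Qed.

Lemma mx_char_mulC (m n : nat) (a : 'M[F]_(m, n)) (b : 'M[F]_(n, m)) :
  mx_char R pcharFp (a *m b) = mx_char R pcharFp (b *m a).
Proof. by rewrite /mx_char mxtrace_mulC. Qed.

(** A single nonzero entry of [c] suffices: a multiple of the elementary matrix at
the transposed position gives [w *m c] any prescribed trace. *)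
Lemma mx_char_nontrivial (m n : nat) (c : 'M[F]_(n, m)) :
  c != 0 -> exists w : 'M[F]_(m, n), mx_char R pcharFp (w *m c) != 1.
Proof.
have [t chart_neq1] := add_char_nontrivial.
case/matrix0Pn => i [j cij_neq0].
exists ((t / c i j) *: delta_mx j i).
suff -> : mx_char R pcharFp ((t / c i j) *: delta_mx j i *m c) =
          add_char R pcharFp t by [].
rewrite /mx_char -scalemxAl mxtraceZ; congr (add_char _ _ _).
rewrite /mxtrace (bigD1 j) //= big1 => [|k k_neqj]; last first.
  by rewrite mxE big1 // => l _; rewrite mxE (negPf k_neqj) mul0r.
rewrite addr0 mxE (bigD1 i) //= big1 => [|l l_neqi]; last first.
  by rewrite mxE (negPf l_neqi) andbF mul0r.
by rewrite mxE !eqxx mul1r addr0 divfK.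
Qed.

(** Orthogonality of characters: for [c != 0], translation by a [w0] at which the
character is not [1] multiplies the sum by a factor other than [1]. *)
Lemma sum_mx_char (m n : nat) (c : 'M[F]_(n, m)) :
  \sum_(w : 'M[F]_(m, n)) mx_char R pcharFp (w *m c) =
    if c == 0 then #|F|%:R ^+ (m * n) else 0.
Proof.
have [->|c_neq0] := eqVneq c 0.
  under eq_bigr do rewrite mulmx0 /mx_char mxtrace0 add_char0.
  by rewrite sumr_const card_mx natrX.
have [w0 charw0_neq1] := mx_char_nontrivial c_neq0.
set S := \sum_w _.
have S_inv : mx_char R pcharFp (w0 *m c) * S = S.
  rewrite {2}/S (reindex_inj (addrI w0)) mulr_sumr; apply: eq_bigr => w _.
  by rewrite mulmxDl mx_charD.
apply/eqP; move/eqP: S_inv; rewrite -subr_eq0 -{2}[S]mul1r -mulrBl mulf_eq0.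
by rewrite subr_eq0 (negPf charw0_neq1).
Qed.

End AdditiveCharacter.

(** * Matrix Kloosterman sums *)

Section Kloosterman.

Variables (R : realType) (F : finFieldType) (p : nat).
Hypothesis pcharFp : p \in [pchar F].

Lemma kloosterman_similar (n : nat) (P a b : 'M[F]_n) :
  P \in unitmx -> P *m a = b *m P ->
  kloosterman R pcharFp a = kloosterman R pcharFp b.
Proof.
move=> P_unit Pa_bP.
pose conj x := P *m x *m invmx P.
have conjK : cancel conj (fun x => invmx P *m x *m P).
  by move=> x; rewrite /conj !mulmxA mulVmx // mul1mx mulmxKV.
have -> : a = invmx P *m b *m P by rewrite -mulmxA -Pa_bP mulKmx.
rewrite /kloosterman [RHS](reindex_inj (can_inj conjK)).
apply: eq_big => [x|x x_unit].
  by rewrite /conj !unitmx_mul unitmx_inv P_unit andbT.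
rewrite !mx_charD; congr (_ * _).
  by rewrite -!mulmxA mx_char_mulC /conj !mulmxA.
have -> : invmx (conj x) = P *m invmx x *m invmx P.
  apply: invmx_uniq; rewrite /conj !mulmxA mulmxKV //.
  by rewrite mulmxK // mulmxV.
by rewrite mx_char_mulC mulKmx.
Qed.

Section BlockSums.

Variables (n1 n2 : nat) (a1 : 'M[F]_n1) (a2 : 'M[F]_n2).

(** The unipotent block matrix with upper right block [v] conjugates the two
matrices exactly when [v *m a2 - a1 *m v = w]. *)
Lemma kloosterman_add_ur (w : 'M[F]_(n1, n2)) :
  coprimep (char_poly a1) (char_poly a2) ->
  kloosterman R pcharFp (block_mx a1 w 0 a2) =
    kloosterman R pcharFp (block_mx a1 0 0 a2).
Proof.
move=> /(sylvester_onto w)[v vw]; apply/esym.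
apply: (@kloosterman_similar _ (block_mx 1%:M v 0 1%:M)).
  by rewrite unitmxE det_ublock !det1 mulr1 unitr1.
rewrite !mulmx_block !mul0mx !mulmx0 !mul1mx !mulmx1 !addr0 !add0r.
by rewrite -vw addrC subrK.
Qed.

(** On the block parabolic subgroup the summand only sees the two diagonal blocks
of [x] and of its inverse, so the upper right block is a free parameter. *)
Lemma sum_unit_ublock :
  \sum_(x : 'M[F]_(n1 + n2) | (x \in unitmx) && (dlsubmx x == 0))
     mx_char R pcharFp (block_mx a1 0 0 a2 *m x + invmx x) =
  #|F|%:R ^+ (n1 * n2) * kloosterman R pcharFp a1 * kloosterman R pcharFp a2.
Proof.
rewrite (reindex_onto
  (fun t : 'M[F]_n1 * 'M[F]_n2 * 'M[F]_(n1, n2) =>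
     block_mx t.1.1 t.2 0 t.1.2)
  (fun x => (ulsubmx x, drsubmx x, ursubmx x))) /=; last first.
  by move=> x /andP[_ /eqP dl0]; rewrite -[RHS]submxK dl0.
transitivity (\sum_(x1 : 'M[F]_n1 | x1 \in unitmx)
    \sum_(x2 : 'M[F]_n2 | x2 \in unitmx) \sum_(y : 'M[F]_(n1, n2))
      mx_char R pcharFp (a1 *m x1 + invmx x1) *
      mx_char R pcharFp (a2 *m x2 + invmx x2)); last first.
  rewrite -mulrA /kloosterman big_distrlr /= mulr_sumr; apply: eq_bigr => x1 _.
  rewrite mulr_sumr; apply: eq_bigr => x2 _.
  by rewrite sumr_const card_mx -[LHS]mulr_natl natrX.
rewrite !pair_big /=; apply: eq_big => [[[x1 x2] y]|[[x1 x2] y]] /=.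
  rewrite block_mxKul block_mxKdl block_mxKur block_mxKdr !eqxx !andbT.
  by rewrite !unitmxE det_ublock unitrM.
rewrite unitmxE det_ublock unitrM -!unitmxE => /andP[/andP[/andP[x1u x2u] _] _].
rewrite invmx_ublock // mulmx_block !mul0mx !mulmx0 !addr0 !add0r.
by rewrite add_block_mx mx_char_block.
Qed.

Lemma kloosterman_block_diag :
  coprimep (char_poly a1) (char_poly a2) ->
  kloosterman R pcharFp (block_mx a1 0 0 a2) =
    #|F|%:R ^+ (n1 * n2) * kloosterman R pcharFp a1 * kloosterman R pcharFp a2.
Proof.
move=> co_a.
have q_neq0 : #|F|%:R ^+ (n1 * n2) != 0 :> R[i].
  rewrite expf_neq0 // pnatr_eq0 -lt0n.
  by apply/card_gt0P; exists 0.
apply: (mulfI q_neq0); rewrite -sum_unit_ublock.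
(* The factor [q ^ (n1 n2)] counts the blocks [w], which all give one sum. *)
transitivity (\sum_(w : 'M[F]_(n1, n2))
    kloosterman R pcharFp (block_mx a1 w 0 a2)).
  under eq_bigr do rewrite kloosterman_add_ur //.
  by rewrite sumr_const card_mx -[RHS]mulr_natl natrX.
rewrite /kloosterman exchange_big /= mulr_sumr big_mkcondr.
apply: eq_bigr => x x_unit.
transitivity (mx_char R pcharFp (block_mx a1 0 0 a2 *m x + invmx x) *
    \sum_(w : 'M[F]_(n1, n2)) mx_char R pcharFp (w *m dlsubmx x)).
  rewrite mulr_sumr; apply: eq_bigr => w _.
  have -> : block_mx a1 w 0 a2 = block_mx a1 0 0 a2 + block_mx 0 w 0 0.
    by rewrite add_block_mx !addr0 add0r.
  rewrite mulmxDl addrAC mx_charD; congr (_ * _).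
  rewrite -[in LHS](submxK x) mulmx_block !mul0mx !addr0 !add0r.
  by rewrite mx_char_block /mx_char mxtrace0 add_char0 mulr1.
rewrite sum_mx_char; case: eqP => _; last by rewrite mulr0.
by rewrite mulrC.
Qed.

End BlockSums.

Lemma kloosterman_diag (n : nat) (d : 'rV[F]_n) :
  injective (d 0) ->
  kloosterman R pcharFp (diag_mx d) =
    #|F|%:R ^+ (n * (n - 1) %/ 2)
      * \prod_(i < n) kloosterman R pcharFp ((d 0 i)%:M : 'M[F]_1).
Proof.
elim: n d => [|n IHn] d d_inj.
  rewrite big_ord0 mulr1 /kloosterman (big_pred1 0) => [|x].
    by rewrite (flatmx0 (_ + _)) /mx_char mxtrace0 add_char0.
    by rewrite unitmxE det_mx00 unitr1; apply/esym/eqP; exact: flatmx0.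
(* [n.+1] is read as [1 + n] from here on, so that the matrix splits into blocks
   of sizes [1] and [n]. *)
pose c : 'rV[F]_n := rsubmx (d : 'rV_(1 + n)).
have cE i : c 0 i = d 0 (lift ord0 i).
  by rewrite mxE; congr (d 0 _); apply: val_inj.
have dE : d = row_mx (d 0 0)%:M c :> 'rV_(1 + n).
  apply: (etrans (esym (hsubmxK (d : 'rV_(1 + n))))); congr row_mx.
  rewrite [LHS]mx11_scalar; congr (_%:M).
  by rewrite mxE; congr (d 0 _); apply: val_inj.
have dgE : diag_mx d = block_mx (d 0 0)%:M 0 0 (diag_mx c) :> 'M[F]_(1 + n).
  apply: (etrans (congr1 (@diag_mx _ (1 + n)) dE)); rewrite diag_mx_row.
  congr block_mx.
  by apply/matrixP => i j; rewrite !mxE !ord1.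
apply: (etrans (congr1 (@kloosterman R F p pcharFp (1 + n)) dgE)).
rewrite kloosterman_block_diag; last first.
  rewrite char_poly_diag char_poly_trig ?scalar_mx_is_trig // big_ord1 mxE.
  rewrite coprimep_sym coprimep_XsubC eqxx mulr1n.
  apply/negP => /rootP; rewrite horner_prod => /eqP/prodf_eq0[i _].
  by rewrite hornerXsubC subr_eq0 cE => /eqP/d_inj.
rewrite IHn => [|i j]; last by rewrite !cE => /d_inj /lift_inj.
rewrite big_ord_recl; under eq_bigr do rewrite cE.
have -> : (n.+1 * (n.+1 - 1) %/ 2 = n + n * (n - 1) %/ 2)%N.
  rewrite -(divnMDl _ _ (isT : 0 < 2)%N); congr (_ %/ _)%N.
  by rewrite !subn1 /= mulSn; case: (n) => // m; rewrite /= mulnC; nia.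
by rewrite exprD mul1n mulrACA.
Qed.

End Kloosterman.

Theorem theorem1p1 (R : realType) (F : finFieldType) (p : nat)
    (pcharFp : p \in [pchar F]) :
  (forall (n1 n2 : nat) (a1 : 'M[F]_n1) (a2 : 'M[F]_n2),
     coprimep (char_poly a1) (char_poly a2) ->
     kloosterman R pcharFp (block_mx a1 0 0 a2) =
       #|F|%:R ^+ (n1 * n2) * kloosterman R pcharFp a1
         * kloosterman R pcharFp a2)
  /\
  (forall (n : nat) (a : 'M[F]_n) (alpha : 'I_n -> F),
     injective alpha ->
     char_poly a = \prod_(i < n) ('X - (alpha i)%:P) ->
     kloosterman R pcharFp a =
       #|F|%:R ^+ (n * (n - 1) %/ 2)
         * \prod_(i < n) kloosterman R pcharFp ((alpha i)%:M : 'M[F]_1)).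
Proof.
split=> [n1 n2 a1 a2|n a alpha alpha_inj chara].
  exact: kloosterman_block_diag.
pose rs := codom alpha.
have rs_uniq : uniq rs by rewrite /rs codomE map_inj_uniq ?enum_uniq.
have rsE : \prod_(r <- rs) ('X - r%:P) = \prod_(i < n) ('X - (alpha i)%:P).
  by rewrite /rs codomE big_map big_enum.
have [P P_unit [d Pad]] := similar_diag_of_distinct_roots rs_uniq
  (etrans chara (esym rsE)).
have ds_perm : perm_eq (codom (d 0)) rs.
  apply: prod_XsubC_eq; rewrite rsE -chara (char_poly_similar P_unit Pad).
  by rewrite char_poly_diag codomE big_map big_enum.
have d_inj : injective (d 0).
  by apply/injectiveP; rewrite /injectiveb /dinjectiveb (perm_uniq ds_perm).
rewrite (kloosterman_similar _ _ P_unit Pad) kloosterman_diag //; congr (_ * _).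
transitivity (\prod_(r <- codom (d 0)) kloosterman R pcharFp (r%:M : 'M[F]_1)).
  by rewrite codomE big_map big_enum.
by rewrite (perm_big _ ds_perm) /rs codomE big_map big_enum.
Qed.
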